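(* Let $X_1,X_2,\ldots$ be i.i.d. with CDF $F=\alpha F_s+(1-\alpha)F_b$, with $\alpha_0$ and $\check F_{s,n}^\gamma$ as defined in the context. Assume that the model is identifiable, i.e. $\alpha=\alpha_0$, that $\alpha_0>0$, and that $F_s$ has a density $f_s$, non-increasing on $[0,\infty)$. Assume that $F_s(0)=0$ and that $F_s$ is concave on $[0,\infty)$. Let $\check\alpha_n$ be an estimator of $\alpha_0$ (taking values in $(0,1]$), let $F_{s,n}^\dagger$ be the least concave majorant of $\check F_{s,n}^{\check\alpha_n}$ on $[0,\infty)$, and let $f_{s,n}^\dagger$ be the left derivative of $F_{s,n}^\dagger$. If $\check\alpha_n\stackrel{P}{\to}\alpha_0$, then, as $n\to\infty$, $$\sup_{x\in\mathbb{R}}|F_{s,n}^\dagger(x)-F_s(x)|\stackrel{P}{\to}0.$$ Further, for any $x>0$ such that $f_s$ is continuous at $x$, $f_{s,n}^\dagger(x)\stackrel{P}{\to}f_s(x)$.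
   Context: Model: $\alpha\in[0,1]$, $F_s\neq F_b$ are CDFs on $\mathbb{R}$, $F=\alpha F_s+(1-\alpha)F_b$, and $\alpha_0:=\inf\{\gamma\in(0,1]:[F-(1-\gamma)F_b]/\gamma\text{ is a CDF}\}$. $\mathbb{F}_n$ is the empirical CDF of $X_1,\dots,X_n$, and for $\gamma\in(0,1]$, $\hat F_{s,n}^\gamma=[\mathbb{F}_n-(1-\gamma)F_b]/\gamma$. $\check F_{s,n}^\gamma$ minimises $W\mapsto\int(W-\hat F_{s,n}^\gamma)^2\,d\mathbb{F}_n$ over all CDFs $W$: $(\check F_{s,n}^\gamma(X_{(i)}))_{i=1}^n$ is the Euclidean projection of $(\hat F_{s,n}^\gamma(X_{(i)}))_{i=1}^n$ onto $\{\theta\in\mathbb{R}^n:0\le\theta_1\le\dots\le\theta_n\le1\}$, where $X_{(i)}$ are the order statistics, and $\check F_{s,n}^\gamma$ is extended to $\mathbb{R}$ as a piecewise constant right-continuous function with possible jumps only at the data points (zero to the left of $X_{(1)}$). The least concave majorant of a bounded function $g:[0,\infty)\to\mathbb{R}$ is the smallest concave function on $[0,\infty)$ lying above $g$. $F_{s,n}^\dagger$ is set to $0$ on $(-\infty,0)$. *)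

(* Defs.v *)
From HB Require Import structures.
From mathcomp Require Import all_boot all_order all_algebra finmap.
From mathcomp Require Import all_classical all_reals all_analysis.

Set Implicit Arguments.
Unset Strict Implicit.
Unset Printing Implicit Defensive.

Import Order.TTheory GRing.Theory Num.Theory.
Import numFieldNormedType.Exports.

Local Open Scope classical_set_scope.
Local Open Scope ring_scope.

Section Model.
Context {R : realType}.
Implicit Types (F G H Fs Fb f : R -> R) (x gamma alpha : R).

Definition is_cdf G : Prop :=
  [/\ {homo G : x y / x <= y},
      right_continuous G,
      G x @[x --> -oo] --> (0 : R) &
      G x @[x --> +oo] --> (1 : R)].

Definition is_density f G : Prop :=
  [/\ measurable_fun setT f,
      (forall x, 0 <= f x) &
      forall x, (G x)%:E = (\int[lebesgue_measure]_(t in `]-oo, x]) (f t)%:E)%E].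

Definition mixture alpha Fs Fb : R -> R :=
  fun x => alpha * Fs x + (1 - alpha) * Fb x.

Definition alpha0 F Fb : R :=
  inf [set gamma | 0 < gamma <= 1 /\
                   is_cdf (fun x => (F x - (1 - gamma) * Fb x) / gamma)].

End Model.

(* Deterministic functionals of a finite sample s (a list of observations). *)
Section Estimators.
Context {R : realType}.
Implicit Types (s : seq R) (Fb g G H : R -> R) (x gamma l : R).

Definition ecdf s x : R := (count (fun t => t <= x) s)%:R / (size s)%:R.

(* 0-based: order_stat s i is $X_{(i+1)}$. *)
Definition order_stat s (i : nat) : R := nth 0 (sort <=%O s) i.

Definition Fs_naive Fb gamma s x : R :=
  (ecdf s x - (1 - gamma) * Fb x) / gamma.

Definition monotone_vectors n : set 'rV[R]_n :=
  [set theta | (forall i, 0 <= theta 0 i <= 1) /\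
               (forall i j : 'I_n, (i <= j)%N -> theta 0 i <= theta 0 j)].

Definition is_projection n (C : set 'rV[R]_n) (y theta : 'rV[R]_n) : Prop :=
  C theta /\
  forall eta, C eta ->
    \sum_i (theta 0 i - y 0 i) ^+ 2 <= \sum_i (eta 0 i - y 0 i) ^+ 2.

(* G takes the fitted value theta_i on [X_(i), X_(i+1)[ (on [X_(n), +oo[ for the
   last index), and 0 to the left of the sample.  In case of ties only the
   last tied index is consulted; the fitted values at tied points agree. *)
Definition is_Fs_check Fb gamma s G : Prop :=
  exists theta : 'rV[R]_(size s),
    [/\ is_projection (@monotone_vectors (size s))
          (\row_i Fs_naive Fb gamma s (order_stat s i)) theta,
        (forall x, (forall i : 'I_(size s), x < order_stat s i) -> G x = 0) &
        (forall (i : 'I_(size s)) x, order_stat s i <= x ->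
           (forall j : 'I_(size s), order_stat s j <= x -> (j <= i)%N) ->
           G x = theta 0 i)].

Definition concave_on (D : set R) (f : R -> R) : Prop :=
  convex_function (D : set R^o) (fun x : R^o => - f x : R^o).

(* Only the values of G on [0, +oo[ are constrained. *)
Definition is_least_concave_majorant g G : Prop :=
  [/\ concave_on `[0, +oo[ G,
      (forall x, 0 <= x -> g x <= G x) &
      forall H, concave_on `[0, +oo[ H -> (forall x, 0 <= x -> g x <= H x) ->
        forall x, 0 <= x -> G x <= H x].

Definition is_left_derivative G x l : Prop :=
  (G (x + h) - G x) / h @[h --> (0 : R)^'-] --> l.

Definition sup_norm g : R := sup (range (fun x => `|g x|)).

End Estimators.

Section Probability.
Context {d : measure_display} {T : measurableType d} {R : realType}.
Variable P : probability T R.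

Definition mutually_independent (X : nat -> {RV P >-> R}) : Prop :=
  forall (J : {fset nat}) (B : nat -> set R),
    (forall i, measurable (B i)) ->
    P (\bigcap_(i in [set` J]) (X i @^-1` B i))
      = (\prod_(i <- J) P (X i @^-1` B i))%E.

(* mu_ext P is the outer probability: it equals P on measurable events
   (measurable_mu_extE), so this is the usual notion for random variables,
   and it is also meaningful when measurability of Y n is not established. *)
Definition cvg_in_probability (Y : nat -> T -> R) (c : R) : Prop :=
  forall e : R, 0 < e ->
    mu_ext P [set w | e < `|Y n w - c|] @[n --> \oo] --> 0%E.

(* The first n observations X_1, ..., X_n are X 0, ..., X n.-1. *)
Definition sample (X : nat -> {RV P >-> R}) (n : nat) (w : T) : seq R :=
  mkseq (fun i => X i w) n.

End Probability.

(* Main.v *)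
Require Import Defs.
From HB Require Import structures.
From mathcomp Require Import all_boot all_order all_algebra finmap.
From mathcomp Require Import all_classical all_reals all_analysis.
From mathcomp Require Import measurable_realfun ring lra.

Set Implicit Arguments.
Unset Strict Implicit.
Unset Printing Implicit Defensive.

Import Order.TTheory GRing.Theory Num.Theory.
Import numFieldNormedType.Exports.

Local Open Scope classical_set_scope.
Local Open Scope ring_scope.

(** Everything reduces to two events of probability tending to 1: the empirical
CDF is uniformly within eta of F, and the estimate gamma of alpha is within eta
of alpha.  On these events the naive estimator is uniformly close to F_s.
Isotonic projection does not move this bound, because F_s, evaluated at the
order statistics, is itself an admissible vector and clipping a candidate to a
band around it never increases the distance to the data.  Between order
statistics the empirical CDF is constant, so F_s varies by O(eta).  Adding a
constant to F_s gives a concave majorant, so the least concave majorant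
inherits the bound, and the left derivative of a concave function lies between
two chord slopes, which for F_s are controlled by the monotone density f_s.
The uniform law of large numbers comes from Chebyshev's inequality on a finite
grid of quantiles; atoms of F force the grid to use both P(X <= t) and
P(X < t). *)

Section Deterministic.
Context {R : realType}.
Implicit Types (F G H Fs Fb f g : R -> R) (x y e h : R) (s : seq R).

(** * Isotonic projection and sup-norm bounds *)

Lemma is_cdf_itv01 G x : is_cdf G -> 0 <= G x <= 1.
Proof.
move=> [G_nd _ GNy Gy]; apply/andP; split.
- by apply: (cvgr_to_le GNy); near=> t; apply: G_nd; near: t;
  apply: nbhs_ninfty_le; exact: num_real.
- by apply: (cvgr_to_ge Gy); near=> t; apply: G_nd; near: t;
  apply: nbhs_pinfty_ge; exact: num_real.
Unshelve. all: by end_near. Qed.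

(** The equality case is the point: [y] lies in the band, so clipping a [t] outside the band brings
    it strictly closer to [y]. *)
Lemma clip_sqr_leif t y (m e : R) : m - e <= y <= m + e ->
  (Num.min (Num.max t (m - e)) (m + e) - y) ^+ 2 <= (t - y) ^+ 2 ?= iff
  (`|t - m| <= e).
Proof.
move=> /andP[ym yM].
case: (leP t (m - e)) => [tm|mt].
  rewrite (min_idPl _); last by lra.
  split.
    have := mulr_ge0 (_ : 0 <= m - e - t) (_ : 0 <= y - t + (y - (m - e))).
    by nra.
  rewrite ler_distl; apply/eqP/idP => [H|/andP[h1 h2]].
    apply/andP; split; nra.
  by congr (_ ^+ 2); lra.
case: (leP t (m + e)) => [tm|me].
  by split=> //; rewrite eqxx ler_distl (ltW mt) tm.
split; first by nra.
rewrite ler_distl; apply/eqP/idP => [H|/andP[h1 h2]].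
  apply/andP; split; nra.
by congr (_ ^+ 2); lra.
Qed.

(** Clipping [theta] to the band of radius [e] around [mu] yields an admissible competitor that is
    at least as close to [y] in every coordinate. Minimality of [theta] then forces every coordinate
    to lie in the band already. *)
Lemma monotone_projection_close n (y mu theta : 'rV[R]_n) (e : R) :
  is_projection (@monotone_vectors R n) y theta -> monotone_vectors mu ->
  (forall i, `|y 0 i - mu 0 i| <= e) -> forall i, `|theta 0 i - mu 0 i| <= e.
Proof.
move=> [[theta01 theta_nd] min_theta] [mu01 mu_nd] y_mu i.
pose eta := \row_j Num.min (Num.max (theta 0 j) (mu 0 j - e)) (mu 0 j + e).
have clipP j : (eta 0 j - y 0 j) ^+ 2 <= (theta 0 j - y 0 j) ^+ 2 ?= iff
    (`|theta 0 j - mu 0 j| <= e).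
  by rewrite mxE; apply: clip_sqr_leif; rewrite -ler_distl.
have e0 : 0 <= e by apply: le_trans (y_mu i).
have eta_mono : monotone_vectors eta.
  split=> [j|j k jk]; rewrite !mxE.
    have := theta01 j; have := mu01 j => /andP[m0 m1] /andP[t0 t1].
    rewrite le_min le_max t0 (addr_ge0 m0 e0)/=.
    by rewrite ge_min ge_max t1/= (_ : mu 0 j - e <= 1)//; lra.
  by rewrite le_min2//; [rewrite le_max2// ?lerB// |rewrite lerD2r];
    rewrite ?theta_nd ?mu_nd.
have /leif_sum/= sumP := fun j (_ : predT j) => clipP j.
(* Minimality is the reverse inequality between the two sums, which is equivalent to the equality
   condition of [sumP], namely that all coordinates satisfy the bound. *)
have := min_theta _ eta_mono; rewrite (ge_leif sumP).
exact: (forallP ^~ i).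
Qed.

(** * Order statistics and the error of the projected estimator *)

Lemma order_stat_le s i j : (i <= j)%N -> (j < size s)%N ->
  order_stat s i <= order_stat s j.
Proof.
move=> ij js; rewrite /order_stat; apply: sorted_leq_nth => //.
- exact: le_trans.
- exact: sort_le_sorted.
- by rewrite inE size_sort (leq_ltn_trans ij).
- by rewrite inE size_sort.
Qed.

Lemma mem_order_stat s t : t \in s ->
  exists i : 'I_(size s), t = order_stat s i.
Proof.
rewrite -(mem_sort <=%O) => /(nthP 0)[i]; rewrite size_sort => ilt <-.
by exists (Ordinal ilt).
Qed.

(** The alternatives match the two clauses of [is_Fs_check]; among tied observations the maximal
    index selects the last one. *)
Lemma last_order_statP s x :
  (forall i : 'I_(size s), x < order_stat s i) \/
  exists i : 'I_(size s), order_stat s i <= x /\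
    forall j : 'I_(size s), order_stat s j <= x -> (j <= i)%N.
Proof.
case: (pickP (fun i : 'I_(size s) => order_stat s i <= x)) => [i0 i0x|nox].
  right; have [//|i ix imax] :=
    @arg_maxnP _ i0 (fun i => order_stat s i <= x) (@nat_of_ord _).
  by exists i; split.
by left => i; rewrite ltNge nox.
Qed.

Lemma ecdf_first s x : (forall i : 'I_(size s), x < order_stat s i) ->
  ecdf s x = 0.
Proof.
move=> xlt; rewrite /ecdf (_ : count _ _ = 0%N) ?mul0r//.
apply/eqP; rewrite -leqn0 leqNgt -has_count.
apply/hasPn => t /mem_order_stat[i ->].
by rewrite -ltNge.
Qed.

Lemma ecdf_last s x (i : 'I_(size s)) : order_stat s i <= x ->
  (forall j : 'I_(size s), order_stat s j <= x -> (j <= i)%N) ->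
  ecdf s x = ecdf s (order_stat s i).
Proof.
move=> ix imax; rewrite /ecdf; congr (_%:R / _); apply: eq_in_count => t.
move=> /mem_order_stat[j ->]; apply/idP/idP => [jx|/le_trans]; last exact.
by rewrite order_stat_le ?imax.
Qed.

(** The term with [gamma] is the error at the order statistics, inherited by the projection from the
    naive estimator. The term with [alpha] bounds the variation of [Fs] from the last order
    statistic up to [x]. *)
Lemma Fs_check_close (alpha gamma eta : R) Fs Fb s G :
  0 < alpha <= 1 -> 0 < gamma -> is_cdf Fs -> is_cdf Fb ->
  is_Fs_check Fb gamma s G ->
  (forall x, `|ecdf s x - mixture alpha Fs Fb x| <= eta) ->
  `|gamma - alpha| <= eta ->
  forall x, `|G x - Fs x| <= 2 * eta / gamma + 2 * eta / alpha.
Proof.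
move=> /andP[a0 a1] g0 cFs cFb [theta [proj G0 Gtheta]] unif gamma_close x.
have naive_close z : `|Fs_naive Fb gamma s z - Fs z| <= 2 * eta / gamma.
  have /andP[s0 s1] := is_cdf_itv01 z cFs.
  have /andP[b0 b1] := is_cdf_itv01 z cFb.
  (* The error splits into the sampling error and the error in the mixing proportion. The latter is
     at most [eta] because [Fs] and [Fb] both take values in [0,1]. *)
  have -> : Fs_naive Fb gamma s z - Fs z =
      (ecdf s z - mixture alpha Fs Fb z
       + (alpha - gamma) * (Fs z - Fb z)) / gamma.
    by rewrite /Fs_naive /mixture; field; rewrite gt_eqF.
  rewrite normrM (gtr0_norm (_ : 0 < gamma^-1)) ?invr_gt0//.
  rewrite ler_pM2r ?invr_gt0//.
  apply: le_trans (ler_normD _ _) _; rewrite mulr_natl mulr2n lerD//.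
  rewrite normrM -[leRHS]mulr1 ler_pM// 1?distrC//.
  by rewrite ler_norml; apply/andP; split; lra.
have eta0 : 0 <= eta by apply: le_trans gamma_close.
(* Since [Fb] is non-decreasing, [alpha] times an increment of [Fs] is at most the increment of the
   mixture. *)
have Fs_var y z : y <= z ->
    mixture alpha Fs Fb z - mixture alpha Fs Fb y <= 2 * eta ->
    0 <= Fs z - Fs y <= 2 * eta / alpha.
  move=> yz; rewrite /mixture ler_pdivlMr//.
  have := let: And4 h _ _ _ := cFs in h _ _ yz.
  have := let: And4 h _ _ _ := cFb in h _ _ yz.
  by move=> hb hs h; apply/andP; split; nra.
have eg0 : 0 <= 2 * eta / gamma by rewrite !mulr_ge0// invr_ge0 ltW.
have [xlt|[i [ix imax]]] := last_order_statP s x.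
  (* To the left of the sample the empirical CDF vanishes, so the mixture, and with it
     [alpha * Fs x], is at most [eta]. *)
  rewrite G0// sub0r normrN.
  have /andP[s0 _] := is_cdf_itv01 x cFs.
  have /andP[b0 _] := is_cdf_itv01 x cFb.
  rewrite ger0_norm//; suff : Fs x <= 2 * eta / alpha by lra.
  have := unif x; rewrite ecdf_first// sub0r normrN ler_norml => /andP[_].
  rewrite /mixture ler_pdivlMr// => h; nra.
rewrite (Gtheta i)//.
have theta_close : `|theta 0 i - Fs (order_stat s i)| <= 2 * eta / gamma.
  have := monotone_projection_close (mu := \row_i Fs (order_stat s i)) proj.
  move=> /(_ (2 * eta / gamma)) H; have := H _ _ i; rewrite mxE; apply.
    split=> [j|j k jk]; rewrite !mxE; first exact: is_cdf_itv01.
    by case: cFs => Fs_nd _ _ _; apply: Fs_nd; exact: order_stat_le.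
  by move=> j; rewrite !mxE.
(* The empirical CDF agrees at [x] and at the order statistic, so the mixture changes by at most
   [2 * eta] between them. *)
have /andP[v0 v1] : 0 <= Fs x - Fs (order_stat s i) <= 2 * eta / alpha.
  apply: Fs_var => //; have := unif x; have := unif (order_stat s i).
  by rewrite (ecdf_last ix imax) !ler_norml => /andP[? ?] /andP[? ?]; lra.
by move: theta_close; rewrite !ler_norml => /andP[? ?]; apply/andP; split; lra.
Qed.

(** * Concave functions and least concave majorants *)

Lemma concave_on_ge f x y t : concave_on `[0, +oo[ f -> 0 <= x -> 0 <= y ->
  0 <= t <= 1 -> t * f x + (1 - t) * f y <= f (t * x + (1 - t) * y).
Proof.
move=> cf x0 y0 /andP[t0 t1].
have := cf (Itv01 t0 t1) x y; rewrite !inE/= !in_itv/= !andbT => /(_ x0 y0).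
rewrite !convRE /= -lerN2 opprK => /(le_trans _); apply.
by rewrite opprD !mulrN !opprK.
Qed.

Lemma concave_on_addc f (c : R) : concave_on `[0, +oo[ f ->
  concave_on `[0, +oo[ (fun x => f x + c).
Proof.
move=> cf t x y xD yD; have := cf t x y xD yD.
by rewrite !convRE /= /unstable.onem; lra.
Qed.

(** The chord inequality with denominators cleared, a form suited to the slope comparisons below. *)
Lemma concave_on_chord f x y z : concave_on `[0, +oo[ f ->
  0 <= x -> x < y -> y < z ->
  (z - y) * f x + (y - x) * f z <= (z - x) * f y.
Proof.
move=> cf x0 xy yz; have zx : 0 < z - x by lra.
have := @concave_on_ge f x z ((z - y) / (z - x)) cf x0.
have -> : 1 - (z - y) / (z - x) = (y - x) / (z - x) by field; lra.
have -> : (z - y) / (z - x) * x + (y - x) / (z - x) * z = y by field; lra.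
have -> : (z - y) / (z - x) * f x + (y - x) / (z - x) * f z =
    ((z - y) * f x + (y - x) * f z) / (z - x) by field; lra.
have t01 : 0 <= (z - y) / (z - x) <= 1.
  by rewrite divr_ge0 ?ler_pdivrMr//; lra.
by move=> /(_ _ t01); rewrite ler_pdivrMr// (mulrC (f y)); apply; lra.
Qed.

(** The upper bound is minimality of [G] against the concave majorant [f + e]; the lower one follows
    from [g <= G]. *)
Lemma least_concave_majorant_close g G f (e : R) :
  is_least_concave_majorant g G -> concave_on `[0, +oo[ f ->
  (forall x, 0 <= x -> `|g x - f x| <= e) ->
  forall x, 0 <= x -> `|G x - f x| <= e.
Proof.
move=> [_ gG Gmin] cf gf x x0.
have Gf : G x <= f x + e.
  apply: (Gmin (fun x => f x + e)) => // [|y y0]; first exact: concave_on_addc.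
  by have := gf _ y0; rewrite ler_distl => /andP[].
have := gf _ x0; have := gG _ x0; rewrite !ler_distl => ? /andP[? ?].
by apply/andP; split; lra.
Qed.

(** * Left derivatives of concave functions and the monotone density *)

Lemma left_derivative_concave_itv G x l h : concave_on `[0, +oo[ G -> 0 < h ->
  h < x -> is_left_derivative G x l ->
  (G (x + h) - G x) / h <= l <= (G x - G (x - h)) / h.
Proof.
move=> cG h0 hx Gl; apply/andP; split.
(* Slopes of chords decrease, so for [- h < k < 0] the difference quotient at [k] lies between the
   forward and backward slopes of step [h]; both bounds pass to the limit. *)
- apply: (cvgr_to_ge Gl); near=> k.
  have k0 : k < 0 by near: k; exact: nbhs_left_lt.
  have kh : - h < k by near: k; apply: nbhs_left_gt; lra.
  have := @concave_on_chord G (x + k) x (x + h) cG.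
  rewrite ler_ndivlMr// mulrAC ler_pdivlMr//.
  by move=> H; have {}H := H ltac:(lra) ltac:(lra) ltac:(lra); nra.
- apply: (cvgr_to_le Gl); near=> k.
  have k0 : k < 0 by near: k; exact: nbhs_left_lt.
  have kh : - h < k by near: k; apply: nbhs_left_gt; lra.
  have := @concave_on_chord G (x - h) (x + k) x cG.
  rewrite ler_ndivrMr// mulrAC ler_pdivrMr//.
  by move=> H; have {}H := H ltac:(lra) ltac:(lra) ltac:(lra); nra.
Unshelve. all: by end_near. Qed.

(** The increment is the integral of [f] over []x, y]], where monotonicity keeps [f] between its
    values at the endpoints. *)
Lemma density_increment f G x y : is_density f G ->
  {in `]0, +oo[ &, {homo f : u v /~ u <= v}} -> 0 < x -> x <= y ->
  (y - x) * f y <= G y - G x <= (y - x) * f x.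
Proof.
move=> [mf f0 Gf] f_ni x0 xy.
have mfE (D : set R) : measurable D -> measurable_fun D (fun t => (f t)%:E).
  by move=> mD; apply/measurable_EFinP; exact: measurable_funS mf.
have GE : ((G y - G x)%:E = \int[lebesgue_measure]_(t in `]x, y]) (f t)%:E)%E.
  rewrite EFinB Gf (_ : `]-oo, y] = `]-oo, x] `|` `]x, y])%classic; last first.
    by rewrite -itv_bndbnd_setU// bnd_simp.
  rewrite ge0_integral_setU//=.
  - by rewrite -Gf addeAC subee// add0e.
  - apply: mfE; exact: measurableU.
  - by move=> t _; rewrite lee_fin.
  - apply/disj_setPS => t [/=]; rewrite !in_itv/= => tx /andP[xt _].
    by move: (lt_le_trans xt tx); rewrite ltxx.
have cst_int c :
    (\int[lebesgue_measure]_(t in `]x, y]) c%:E = ((y - x) * c)%:E)%E.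
  rewrite integral_cst//= lebesgue_measure_itv/= lte_fin.
  case: ltP => [_|yx]; first by rewrite -EFinB -EFinM mulrC.
  have -> : y = x by apply/eqP; rewrite eq_le yx xy.
  by rewrite mule0 subrr mul0r.
rewrite -!lee_fin GE -!cst_int.
apply/andP; split; apply: ge0_le_integral => //=.
- by move=> t _; rewrite lee_fin.
- exact: mfE.
- move=> t; rewrite in_itv/= lee_fin => /andP[xt ty].
  by apply: f_ni => //; rewrite in_itv/= andbT; lra.
- by move=> t _; rewrite lee_fin.
- exact: mfE.
- move=> t; rewrite in_itv/= lee_fin => /andP[xt ty].
  by apply: f_ni; rewrite ?in_itv/= ?andbT; lra.
Qed.

(** The radius [delta] is chosen before [G], so that one uniform bound serves every realisation of a
    random concave function. *)
Lemma left_derivative_concave_close f F x e : is_density f F ->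
  {in `]0, +oo[ &, {homo f : u v /~ u <= v}} -> 0 < x ->
  {for x, continuous f} -> 0 < e ->
  exists2 delta, 0 < delta & forall G l, concave_on `[0, +oo[ G ->
    (forall y, 0 <= y -> `|G y - F y| <= delta) -> is_left_derivative G x l ->
    `|l - f x| <= e.
Proof.
move=> dF f_ni x0 fx e0.
have e20 : 0 < e / 2 by lra.
have /cvgrPdist_le/(_ _ e20)/nbhs_ballP[r /= r0 fr] := fx.
(* Step [h] is below [r], so that [f (x - h)] and [f (x + h)] are within [e / 2] of [f x], and below
   [x], so that [x - h] stays positive. *)
pose h := Num.min (r / 2) (x / 2).
have h0 : 0 < h by rewrite lt_min; apply/andP; split; lra.
have hr : h < r by rewrite gt_min (_ : r / 2 < r)//; lra.
have hx : h < x by rewrite gt_min (_ : x / 2 < x) ?orbT//; lra.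
(* Chord slopes of [G] and [F] over a step [h] differ by at most [2 * delta / h = e / 2]; continuity
   of [f] accounts for the other half. *)
exists (e * h / 4) => [|G l cG GF Gl]; first by rewrite !mulr_gt0.
have := left_derivative_concave_itv cG h0 hx Gl.
rewrite ler_pdivrMr// ler_pdivlMr// => /andP[lo hi].
have := @density_increment f F x (x + h) dF f_ni x0 ltac:(lra).
have := @density_increment f F (x - h) x dF f_ni ltac:(lra) ltac:(lra).
have -> : x - (x - h) = h by ring.
have -> : x + h - x = h by ring.
move=> /andP[_ up] /andP[dn _].
have := fr (x + h) _; have := fr (x - h) _; rewrite /ball/=.
have -> : x - (x - h) = h by ring.
have -> : x - (x + h) = - h by ring.
rewrite normrN gtr0_norm// => /(_ hr) + /(_ hr).
have := GF x ltac:(lra); have := GF (x + h) ltac:(lra).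
have := GF (x - h) ltac:(lra).
rewrite !ler_norml => /andP[? ?] /andP[? ?] /andP[? ?] /andP[? ?] /andP[? ?].
by apply/andP; split; nra.
Qed.

Lemma sup_norm_close f e : (forall x, `|f x| <= e) -> `|sup_norm f| <= e.
Proof.
move=> fe; rewrite ger0_norm.
  by apply: ge_sup; [exists `|f 0|, 0|move=> _ [x _ <-]].
apply: le_trans (normr_ge0 (f 0)) _; apply: ub_le_sup; last by exists 0.
by exists e => _ [x _ <-].
Qed.

(** * Quantile grids and uniform closeness of the empirical CDF *)

Lemma cdf_quantile F q : is_cdf F -> 0 < q < 1 ->
  exists t, q <= F t /\ forall u, u < t -> F u < q.
Proof.
move=> [F_nd F_rc FNy Fy] /andP[q0 q1].
(* The quantile is the infimum of [A]: the limits of [F] make [A] nonempty and bounded below, and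
   right continuity puts the infimum in [A]. *)
pose A := [set u | q <= F u].
have A0 : A !=set0.
  have /cvgr_ge/(_ _ q1)[M [_ MA]] := Fy.
  by exists (M + 1); apply: MA; lra.
have lbA : has_lbound A.
  have /cvgr_lt/(_ _ q0)[M [_ MA]] := FNy.
  exists (M - 1) => u qu; rewrite leNgt; apply/negP => uM.
  by have := MA u ltac:(lra); rewrite ltNge qu.
exists (inf A); split; last first.
  by move=> u; apply: contraTlt; rewrite -leNgt => uA; exact: ge_inf.
apply: (cvgr_to_ge (F_rc (inf A))); near=> u.
have ui : 0 < u - inf A by rewrite subr_gt0; near: u; exact: nbhs_right_gt.
have [v Av] := inf_adherent ui (conj A0 lbA).
by rewrite addrC subrK => /ltW/F_nd; apply: le_trans.
Unshelve. all: by end_near. Qed.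

(** Empirical version of P(X < x). It bounds [ecdf] to the left of a grid point without counting an
    atom sitting there. *)
Definition ecdf_lt s x : R := (count (fun t => t < x) s)%:R / (size s)%:R.

Lemma ecdf_itv01 s x : 0 <= ecdf s x <= 1.
Proof.
rewrite /ecdf divr_ge0//=; case: s => [|t s]; first by rewrite mul0r.
by rewrite ler_pdivrMr ?ltr0n// mul1r ler_nat count_size.
Qed.

Lemma ecdf_nd s x y : x <= y -> ecdf s x <= ecdf s y.
Proof.
move=> xy; rewrite ler_wpM2r ?invr_ge0// ler_nat; apply: sub_count => t /= tx.
exact: le_trans xy.
Qed.

Lemma ecdf_le_lt s x y : x < y -> ecdf s x <= ecdf_lt s y.
Proof.
move=> xy; rewrite ler_wpM2r ?invr_ge0// ler_nat; apply: sub_count => t /= tx.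
exact: le_lt_trans xy.
Qed.

(** Here [t j] is the quantile of level [j / k] and [p j] stands for P(X < t j). If [F x] lies in
    the level cell of index [j], then [x] is at or after [t j] and before [t j.+1]: the first gives
    the lower bound through [F (t j)], the second the upper bound through [p j.+1]. *)
Lemma ecdf_close_on_grid F s k (t p : nat -> R) (eta : R) : is_cdf F ->
  0 <= eta -> (0 < k)%N ->
  (forall j, (0 < j < k)%N -> [/\ j%:R / k%:R <= F (t j),
     forall u, u < t j -> F u < j%:R / k%:R & p j <= j%:R / k%:R]) ->
  (forall j, (0 < j < k)%N -> `|ecdf s (t j) - F (t j)| <= eta /\
                              `|ecdf_lt s (t j) - p j| <= eta) ->
  forall x, `|ecdf s x - F x| <= k%:R^-1 + eta.
Proof.
move=> cF eta0 k0 grid close x.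
have /andP[Fx0 Fx1] := is_cdf_itv01 x cF.
have /andP[Ex0 Ex1] := ecdf_itv01 s x.
have kR0 : (0 : R) < k%:R by rewrite ltr0n.
have [j /andP[jF Fj]] : exists j, j%:R <= k%:R * F x < j.+1%:R.
  by exists (Num.truncn (k%:R * F x)); rewrite truncn_itv// mulr_ge0// ltW.
have kV : k%:R * (k%:R)^-1 = 1 :> R by rewrite mulfV// gt_eqF.
have kV0 : (0:R) < k%:R^-1 by rewrite invr_gt0.
rewrite ler_distl; apply/andP; split.
(* Lower bound. The index is capped at [k.-1] because [F x = 1] gives [j = k], which has no grid
   point. If the capped index is 0, then [F x] is at most [1 / k] and [ecdf] being nonnegative
   suffices. *)
- have [i0|i_gt0] := posnP (minn j k.-1).
    suff : F x <= k%:R^-1 by lra.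
    rewrite -(ler_pM2l kR0) kV; move/eqP: i0; rewrite -leqn0 geq_min.
    move=> /orP[|k1]; first by rewrite leqn0 => /eqP j0; rewrite j0 in Fj; lra.
    have -> : k = 1%N by case: (k) k0 k1 => [|[]].
    by lra.
  set i := minn j k.-1 in i_gt0.
  have ik : (0 < i < k)%N by rewrite i_gt0/= gtn_min ltn_predL k0 orbT.
  have [h1 h2 _] := grid i ik; have [] := close i ik.
  have ij : i%:R / k%:R <= F x.
    rewrite ler_pdivrMr// mulrC; apply: le_trans jF.
    by rewrite ler_nat geq_minl.
  have Fi : F x <= i%:R / k%:R + k%:R^-1.
    rewrite -[X in _ + X]mul1r -mulrDl ler_pdivlMr// mulrC natr1.
    rewrite /i /minn; case: ifP => [_|/negbT]; first by rewrite ltW.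
    by move=> _; rewrite prednK//; nra.
  have tx : t i <= x.
    by rewrite leNgt; apply/negP => /h2; rewrite ltNge ij.
  have := ecdf_nd s tx.
  by rewrite ler_distl => ? /andP[? ?] _; lra.
(* Upper bound. In the last cells [F x + 1 / k] already reaches 1. *)
- have [kj|jk1] := leqP k j.+1.
    suff : 1 <= F x + k%:R^-1 by lra.
    rewrite -(ler_pM2l kR0) mulrDr kV mulr1.
    by apply: le_trans (_ : j%:R + 1 <= _); [rewrite natr1 ler_nat|lra].
  have [h1 h2 h3] := grid j.+1 jk1.
  have [_] := close j.+1 jk1.
  have xt : x < t j.+1.
    rewrite ltNge; apply/negP => tx.
    have : F (t j.+1) <= F x by case: cF => + _ _ _; apply.
    rewrite leNgt => /negP; apply; apply: lt_le_trans h1.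
    by rewrite ltr_pdivlMr// mulrC.
  have := ecdf_le_lt s xt.
  have : j.+1%:R / k%:R <= F x + k%:R^-1.
    by rewrite ler_pdivrMr// mulrDl mulVf ?gt_eqF// -natr1 lerD2r mulrC.
  by rewrite ler_distl => ? ? /andP[? ?]; lra.
Qed.

End Deterministic.

(** * Events whose probability tends to 1 *)

Section Asymptotics.
Context {d : measure_display} {T : measurableType d} {R : realType}.
Variable P : probability T R.
Implicit Types (S : nat -> set T) (Y : nat -> T -> R) (A : nat -> set T).

(** Outer probability lets [S n] involve all real [x] and the estimators without a measurability
    argument; monotonicity and subadditivity carry over. *)
Definition asymptotically_sure S : Prop :=
  mu_ext P (~` S n) @[n --> \oo] --> 0%E.

Lemma asymptotically_sureW S S' : (forall n, S n `<=` S' n) ->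
  asymptotically_sure S -> asymptotically_sure S'.
Proof.
move=> SS' aS; apply: (squeeze_cvge _ (cvg_cst _) aS); apply: nearW => n.
apply/andP; split; first exact: mu_ext_ge0.
by apply: le_mu_ext; exact: subsetC.
Qed.

Lemma asymptotically_sureI S S' : asymptotically_sure S ->
  asymptotically_sure S' -> asymptotically_sure (fun n => S n `&` S' n).
Proof.
move=> aS aS'.
have aSS' : (mu_ext P (~` S n) + mu_ext P (~` S' n))%E @[n --> \oo] --> 0%E.
  by rewrite -[X in _ --> X]adde0; exact: cvgeD.
apply: (squeeze_cvge _ (cvg_cst _) aSS'); apply: nearW => n.
apply/andP; split; first exact: mu_ext_ge0.
by rewrite setCI; exact: outer_measureU2.
Qed.

Lemma asymptotically_sureT : asymptotically_sure (fun=> setT).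
Proof. by rewrite /asymptotically_sure setCT mu_ext0//; exact: cvg_cst. Qed.

Lemma asymptotically_sure_forall k (S : nat -> nat -> set T) :
  (forall j, (j < k)%N -> asymptotically_sure (S j)) ->
  asymptotically_sure (fun n => [set w | forall j, (j < k)%N -> S j n w]).
Proof.
elim: k => [|k IH] aS.
  by apply: asymptotically_sureW asymptotically_sureT.
have := asymptotically_sureI (IH (fun j jk => aS j (ltnW jk))) (aS k (leqnn _)).
apply: asymptotically_sureW => n w [Sj Sk] j; rewrite ltnS leq_eqVlt.
by move=> /predU1P[->//|]; exact: Sj.
Qed.

Lemma cvg_in_probabilityP Y c : cvg_in_probability P Y c <->
  forall e, 0 < e -> asymptotically_sure (fun n => [set w | `|Y n w - c| <= e]).
Proof.
have E e : (fun n => mu_ext P (~` [set w | `|Y n w - c| <= e])) =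
           (fun n => mu_ext P [set w | e < `|Y n w - c|]).
  apply/funext => n; congr mu_ext; apply/seteqP.
  by split=> w /=; [move/negP; rewrite -ltNge | rewrite ltNge => /negP].
by split=> H e /H; rewrite /asymptotically_sure E.
Qed.

Lemma Lfun_indic (A : set T) : measurable A -> (\1_A : T -> R) \in Lfun P 2%:E.
Proof.
move=> mA; rewrite inE/=; apply/andP; split; rewrite inE//=.
rewrite /finite_norm unlock poweR_lty//.
rewrite (_ : (\int[P]_x _)%E = (\int[P]_x (\1_A x)%:E)%E).
  by rewrite integral_indic// setIT (le_lt_trans (probability_le1 _ _)) ?ltry.
apply: eq_integral => x _ /=; rewrite indicE.
by case: (_ \in _); rewrite /= ?normr1 ?normr0 ?powR1 ?powR0// gt_eqF.
Qed.

(** * Weak law for frequencies of pairwise independent events *)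

Section WeakLaw.
Variables (A : nat -> set T) (p : R).
Hypothesis mA : forall i, measurable (A i).
Hypothesis PA : forall i, P (A i) = p%:E.
Hypothesis PAI : forall i j, i != j -> P (A i `&` A j) = (p * p)%:E.

Let S n : T -> R := \sum_(i < n) \1_(A i).

Let P_fin : P setT \is a fin_num. Proof. exact: fin_num_measure. Qed.

Let Lfun_S n : S n \in Lfun P 2%:E.
Proof. by rewrite rpred_sum ?lee1n//= => p1 i _; exact: Lfun_indic. Qed.

Let SS n : S n.+1 = S n \+ \1_(A n).
Proof. by rewrite /S big_ord_recr. Qed.

Let expectation_S n : ('E_P[S n] = (n%:R * p)%:E)%E.
Proof.
elim: n => [|n IH].
  by rewrite /S big_ord0 mul0r; exact: expectation_cst.
rewrite SS expectationD; last 2 first.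
- exact: Lfun_subset12.
- exact/Lfun_subset12/Lfun_indic.
by rewrite IH expectation_indic// PA -EFinD mulrS mulrDl mul1r addrC.
Qed.

Let covariance_indic i j : i != j ->
  covariance P (\1_(A i) : T -> R) (\1_(A j) : T -> R) = 0%E.
Proof.
move=> ij; rewrite covarianceE.
- rewrite (_ : (\1_(A i) * \1_(A j))%R = \1_(A i `&` A j)); last first.
    by apply/funext => w; rewrite indicI.
  rewrite !expectation_indic//; last exact: measurableI.
  by rewrite !PA PAI// -EFinM -EFinB subrr.
- exact/Lfun_subset12/Lfun_indic.
- exact/Lfun_subset12/Lfun_indic.
- by apply: Lfun2_mul_Lfun1; exact: Lfun_indic.
Qed.

Let covariance_S n m : (n <= m)%N ->
  covariance P (S n) (\1_(A m) : T -> R) = 0%E.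
Proof.
elim: n => [_|n IH nm].
  by rewrite /S big_ord0; exact: covariance_cst_l.
rewrite SS covarianceDl//; [|exact: Lfun_indic..].
by rewrite IH 1?ltnW// covariance_indic ?add0e// neq_ltn nm.
Qed.

(** Each new indicator is uncorrelated with the preceding sum and has variance [p - p ^+ 2], at most
    1. *)
Let variance_S n : ('V_P[S n] <= n%:R%:E)%E.
Proof.
elim: n => [|n IH].
  by rewrite /S big_ord0 (_ : 'V_P[_] = 0%E)//; exact: variance_cst.
rewrite SS varianceD//; last exact: Lfun_indic.
rewrite covariance_S// mule0 adde0 -natr1 EFinD leeD//.
rewrite varianceE; last exact: Lfun_indic.
rewrite expectation_indic// PA.
rewrite (_ : (\1_(A n) ^+ 2)%R = \1_(A n)); last first.
  rewrite expr2; apply/funext => w; rewrite fctE indicE.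
  by case: (_ \in _); rewrite ?mulr1 ?mulr0.
rewrite expectation_indic// PA -EFin_expe -EFinB lee_fin.
have : p <= 1 by rewrite -lee_fin -(PA 0) probability_le1.
by have := sqr_ge0 p; lra.
Qed.

Lemma weak_law_frequency (e : R) : 0 < e ->
  asymptotically_sure
    (fun n => [set w | `|(\sum_(i < n) \1_(A i) w) / n%:R - p| <= e]).
Proof.
move=> e0; set good := (X in asymptotically_sure X).
have bound n : (0 < n)%N -> (mu_ext P (~` good n) <= (e ^- 2 * n%:R^-1)%:E)%E.
  move=> n0; have n0R : (0 : R) < n%:R by rewrite ltr0n.
  have mS : S n \in mfun by exact: sub_Lfun_mfun (Lfun_S n).
  pose X : {RV P >-> R} := mfun_Sub mS.
  have XE w : X w = \sum_(i < n) \1_(A i) w by rewrite /X/= /S fct_sumE.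
  have ne0 : 0 < n%:R * e by rewrite mulr_gt0.
  have := chebyshev X ne0; set B := [set w | _] => PB.
  have mB : measurable B.
    rewrite -[B]setTI; apply: measurable_fun_le => //.
    apply: measurableT_comp => //; exact: measurable_funB.
  apply: le_trans (_ : mu_ext P B <= _)%E.
    (* Multiplying the deviation by [n] places the bad event inside Chebyshev's event for [S n] at
       level [n * e]. *)
    apply: le_mu_ext => w /= /negP; rewrite -ltNge => ew.
    rewrite /B /mkset XE (expectation_S n : ('E_P[X] = _)%E)/=.
    rewrite -[leRHS](_ : n%:R * `|(\sum_(i < n) \1_(A i) w) / n%:R - p| = _).
      by rewrite ler_wpM2l ?ltW.
    rewrite -[X in X * _ = _](gtr0_norm n0R) -normrM; congr (`|_|).
    by field; rewrite gt_eqF.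
  rewrite measurable_mu_extE//; apply: (le_trans PB).
  apply: (@le_trans _ _ (((n%:R * e) ^- 2)%:E * n%:R%:E)%E).
    by apply: lee_wpmul2l; [rewrite lee_fin invr_ge0 sqr_ge0|exact: variance_S].
  rewrite -EFinM lee_fin le_eqVlt; apply/orP; left; apply/eqP.
  by field; rewrite !gt_eqF.
have bound0 : (e ^- 2 * n.+1%:R^-1)%:E @[n --> \oo] --> 0%E.
  apply: cvg_EFin; first exact: nearW.
  by rewrite -[X in _ --> X](mulr0 (e ^- 2)); apply: cvgMr; exact: cvg_harmonic.
(* The bound holds for positive [n], hence the shift by one. *)
rewrite /asymptotically_sure -cvg_shiftS.
apply: (squeeze_cvge _ (cvg_cst _) bound0); apply: nearW => n.
by rewrite bound// mu_ext_ge0.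
Qed.

End WeakLaw.

(** * Uniform law of large numbers for the empirical CDF *)

Variable X : nat -> {RV P >-> R}.
Hypothesis indepX : mutually_independent X.

Lemma independent_preimage_pair (B : set R) (p : R) i j : measurable B ->
  (forall k, P (X k @^-1` B) = p%:E) -> i != j ->
  P ((X i @^-1` B) `&` (X j @^-1` B)) = (p * p)%:E.
Proof.
move=> mB PB ij; have := indepX [fset i; j]%fset (fun=> mB).
have -> : \bigcap_(k in [set` [fset i; j]%fset]) (X k @^-1` B) =
    (X i @^-1` B) `&` (X j @^-1` B).
  apply/seteqP; split=> [w Bw|w [Bi Bj] k /=].
    by split; apply: Bw; rewrite /= !inE eqxx ?orbT.
  by rewrite !inE => /orP[] /eqP->.
move=> ->; rewrite big_fsetU1/= ?inE// big_seq_fset1.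
by rewrite !PB EFinM.
Qed.

(** A general predicate [b] makes both [ecdf] and [ecdf_lt] instances. *)
Lemma weak_law_sample (b : pred R) (p : R) : measurable [set t | b t] ->
  (forall i, P (X i @^-1` [set t | b t]) = p%:E) -> forall e, 0 < e ->
  asymptotically_sure
    (fun n => [set w |
       `|(count b (sample X n w))%:R / (size (sample X n w))%:R - p| <= e]).
Proof.
move=> mb Pb e e0.
have mA i : measurable (X i @^-1` [set t | b t]).
  by rewrite -[X in measurable X]setTI; exact: measurable_funPT.
have PbI i j := @independent_preimage_pair _ p i j mb Pb.
have := weak_law_frequency mA Pb PbI e0.
apply: asymptotically_sureW => n w /=; rewrite size_mkseq.
suff -> : (count b (sample X n w))%:R =
    \sum_(i < n) \1_(X i @^-1` [set t | b t]) w :> R by [].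
rewrite -sum1_count big_map natr_sum big_mkcond/=.
rewrite -(big_mkord xpredT (fun i => \1_(X i @^-1` [set t | b t]) w)).
rewrite /index_iota subn0.
apply: eq_bigr => i _; rewrite indicE; case: ifPn => bX.
  by rewrite mem_set.
by rewrite memNset//=; exact/negP.
Qed.

Lemma measurable_le_set (x : R) : measurable [set t : R | t <= x].
Proof. by have := @measurable_itv R `]-oo, x]; rewrite set_itvE. Qed.

Lemma measurable_lt_set (x : R) : measurable [set t : R | t < x].
Proof. by have := @measurable_itv R `]-oo, x[; rewrite set_itvE. Qed.

(** Continuity of [P] from below. It recovers P(Z < x) from the CDF, the only information given on
    the law of each observation. *)
Lemma cvg_cdf_left (Z : {RV P >-> R}) x :
  cdf Z (x - n.+1%:R^-1) @[n --> \oo] --> P (Z @^-1` [set t | t < x]).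
Proof.
have -> : Z @^-1` [set t | t < x] = \bigcup_n (Z @^-1` `]-oo, x - n.+1%:R^-1]).
  apply/seteqP; split=> [w /= /ltr_add_invr[n nx]|w [n _]];
    rewrite /= ?in_itv/=.
    by exists n => //=; rewrite in_itv/= lerBrDr ltW.
  by move=> /le_lt_trans; apply; rewrite gtrBl invr_gt0.
have mF n : measurable (Z @^-1` `]-oo, x - n.+1%:R^-1]).
  by rewrite -[X in measurable X]setTI; exact: measurable_funPT.
apply: nondecreasing_cvg_mu => //; first exact: bigcup_measurable.
move=> n m nm; apply/subsetPset => w /=; rewrite !in_itv/= => /le_trans; apply.
by rewrite lerD2l lerN2 lef_pV2 ?posrE// ler_nat.
Qed.

Lemma glivenko_cantelli (F : R -> R) : is_cdf F ->
  (forall i x, cdf (X i) x = (F x)%:E) -> forall e, 0 < e ->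
  asymptotically_sure
    (fun n => [set w | forall x, `|ecdf (sample X n w) x - F x| <= e]).
Proof.
move=> cF XF e e0.
have e20 : 0 < e / 2 by rewrite divr_gt0.
have [m] := ltr_add_invr e20; rewrite add0r => ke.
set k := m.+1 in ke.
have /choice[t tP] j : exists t, (0 < j < k)%N ->
    j%:R / k%:R <= F t /\ forall u, u < t -> F u < j%:R / k%:R.
  have [/andP[j0 jk]|_] := boolP (0 < j < k)%N; last by exists 0.
  have [|t tP] := @cdf_quantile R F (j%:R / k%:R) cF; last by exists t.
  by rewrite divr_gt0 ?ltr0n//= ltr_pdivrMr ?ltr0n// mul1r ltr_nat.
pose p j : R := fine (P (X 0 @^-1` [set u | u < t j])).
have cvg_p i j : (F (t j - n.+1%:R^-1))%:E @[n --> \oo] -->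
    P (X i @^-1` [set u | u < t j]).
  by under eq_fun do rewrite -(XF i); exact: cvg_cdf_left.
(* All observations share the CDF [F], so uniqueness of its left limit makes this probability
   independent of [i]. *)
have Pp i j : P (X i @^-1` [set u | u < t j]) = (p j)%:E.
  rewrite fineK ?fin_num_measure//.
    exact: cvg_unique (cvg_p i j) (cvg_p 0%N j).
  by rewrite -[X in measurable X]setTI; apply: measurable_funPT => //;
    exact: measurable_lt_set.
have PF i x : P (X i @^-1` [set u | u <= x]) = (F x)%:E.
  by rewrite -(XF i) /cdf /distribution /pushforward set_itvE.
have := @asymptotically_sure_forall k _ (fun j jk => asymptotically_sureI
  (weak_law_sample (measurable_le_set (t j)) (fun i => PF i (t j)) e20)
  (weak_law_sample (measurable_lt_set (t j)) (fun i => Pp i j) e20)).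
apply: asymptotically_sureW => n w /= close x.
apply: le_trans (_ : k%:R^-1 + e / 2 <= _); last by lra.
apply: (@ecdf_close_on_grid _ F _ k t p) => // [|j jk|j /andP[_ jk]].
- by lra.
(* The bound on [p j] holds since [F] stays below [j / k] to the left of [t j]. *)
- have [t1 t2] := tP _ jk; split => //; rewrite -lee_fin -(Pp 0%N).
  apply: (cvge_to_le (cvg_p 0%N j)); apply: nearW => i.
  by rewrite lee_fin ltW// t2// gtrBl invr_gt0.
- exact: close.
Qed.

End Asymptotics.

(** * The mixture model and the two consistency statements *)

Lemma is_cdf_mixture {R : realType} alpha (Fs Fb : R -> R) : 0 <= alpha <= 1 ->
  is_cdf Fs -> is_cdf Fb -> is_cdf (mixture alpha Fs Fb).
Proof.
move=> /andP[a0 a1] [s_nd s_rc sN s_y] [b_nd b_rc bN b_y].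
have mix_cvg (T : Type) (A : set_system T) (FA : Filter A) (f g : T -> R) u v :
    f x @[x --> A] --> u -> g x @[x --> A] --> v ->
    alpha * f x + (1 - alpha) * g x @[x --> A] --> alpha * u + (1 - alpha) * v.
  by move=> fu gv; apply: cvgD; apply: cvgMr.
split.
- move=> x y xy; rewrite lerD// ler_wpM2l ?subr_ge0//; first exact: s_nd.
  exact: b_nd.
- by move=> x; exact: mix_cvg.
- by rewrite [X in _ --> X](_ : _ = alpha * 0 + (1 - alpha) * 0);
    [exact: mix_cvg|ring].
- by rewrite [X in _ --> X](_ : _ = alpha * 1 + (1 - alpha) * 1);
    [exact: mix_cvg|ring].
Qed.

Theorem theorem9 (R : realType) (d : measure_display) (T : measurableType d)
    (P : probability T R)
    (alpha : R) (Fs Fb fs : R -> R)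
    (X : nat -> {RV P >-> R})
    (alpha_check : nat -> {RV P >-> R})
    (Fs_check Fs_dag fs_dag : nat -> T -> R -> R) :
  let F := mixture alpha Fs Fb in
  0 <= alpha <= 1 ->
  is_cdf Fs -> is_cdf Fb -> Fs <> Fb ->
  mutually_independent X ->
  (forall i x, cdf (X i) x = (F x)%:E) ->
  alpha = alpha0 F Fb ->
  0 < alpha0 F Fb ->
  is_density fs Fs ->
  (forall x y, 0 <= x -> x <= y -> fs y <= fs x) ->
  Fs 0 = 0 ->
  concave_on `[0, +oo[ Fs ->
  (forall n w, 0 < alpha_check n w <= 1) ->
  (forall n w, is_Fs_check Fb (alpha_check n w) (sample X n w) (Fs_check n w)) ->
  (forall n w, is_least_concave_majorant (Fs_check n w) (Fs_dag n w)) ->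
  (forall n w x, x < 0 -> Fs_dag n w x = 0) ->
  (forall n w x, 0 < x -> is_left_derivative (Fs_dag n w) x (fs_dag n w x)) ->
  cvg_in_probability P alpha_check (alpha0 F Fb) ->
  cvg_in_probability P
    (fun n w => sup_norm (fun x => Fs_dag n w x - Fs x)) 0
  /\ (forall x, 0 < x -> {for x, continuous fs} ->
        cvg_in_probability P (fun n w => fs_dag n w x) (fs x)).

Proof.
move=> F alpha01 cFs cFb _ indepX XF alphaE alpha0_gt0 dFs fs_ni Fs0 concFs
  gamma01 checkP dagP dag_neg dagD alpha_cvg.
(* Identifiability enters here: the estimator converges to the true mixing proportion. *)
rewrite -alphaE in alpha0_gt0 alpha_cvg.
have cF : is_cdf F by exact: is_cdf_mixture.
have dag_close e : 0 < e -> asymptotically_sure P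
    (fun n => [set w | forall x, `|Fs_dag n w x - Fs x| <= e]).
  (* The first bound gives [alpha_check n w >= alpha / 2], so the total error is at most
     [6 * eta / alpha]; the second makes this at most [e]. *)
  move=> e0; pose eta := Num.min (alpha / 2) (alpha * e / 6).
  have eta0 : 0 < eta by rewrite lt_min divr_gt0//= divr_gt0// mulr_gt0.
  have etaa : eta <= alpha / 2 by rewrite ge_min lexx.
  have etae : eta <= alpha * e / 6 by rewrite ge_min lexx orbT.
  have := asymptotically_sureI (glivenko_cantelli indepX cF XF eta0)
    ((cvg_in_probabilityP P _ _).1 alpha_cvg _ eta0).
  apply: asymptotically_sureW => n w /= [GC gamma_close] x.
  (* On the negative half-line both functions vanish, [Fs] by monotonicity and [Fs 0 = 0]. *)
  have [x0|x0] := ltP x 0.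
    have /andP[s0 _] := is_cdf_itv01 x cFs.
    have s1 : Fs x <= 0.
      by rewrite -Fs0; case: cFs => + _ _ _; apply; exact: ltW.
    by rewrite dag_neg// ler_norml; apply/andP; split; lra.
  apply: least_concave_majorant_close (dagP n w) concFs _ _ x0 => y _.
  have g0 : 0 < alpha_check n w by case/andP: (gamma01 n w).
  have a01 : 0 < alpha <= 1 by rewrite alpha0_gt0; case/andP: alpha01.
  have := Fs_check_close a01 g0 cFs cFb (checkP n w) GC gamma_close y.
  move=> /le_trans; apply.
  have gamma_ge : alpha / 2 <= alpha_check n w.
    by move: gamma_close; rewrite ler_distl => /andP[? ?]; lra.
  have -> : e = 2 * (alpha * e / 6) / (alpha / 2) + 2 * (alpha * e / 6) / alpha.
    by field; rewrite gt_eqF.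
  have a2 : 0 < alpha / 2 by lra.
  rewrite lerD// ?ler_pM2r ?invr_gt0//; last by lra.
  by rewrite ler_pM ?invr_ge0 ?lef_pV2 ?posrE//; lra.
split.
  apply/cvg_in_probabilityP => e e0.
  apply: asymptotically_sureW (dag_close _ e0) => n w /= dagF.
  by rewrite subr0; exact: sup_norm_close.
move=> x x0 fsx; apply/cvg_in_probabilityP => e e0.
have fs_ni' : {in `]0, +oo[ &, {homo fs : u v /~ u <= v}}.
  move=> u v _; rewrite in_itv/= andbT => v0 uv.
  by apply: fs_ni => //; exact: ltW.
have [delta delta0 dP] := left_derivative_concave_close dFs fs_ni' x0 fsx e0.
apply: asymptotically_sureW (dag_close _ delta0) => n w /= dagF.
apply: dP (dagD n w x x0) => [|y _]; last exact: dagF.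
by case: (dagP n w).
Qed.
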